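(* If $\mathcal{B}=(\mathbf{x}_n)_{n=1}^\infty$ is a quasi-greedy basis of a quasi-Banach space $\mathbb{X}$, then $\mathcal{B}$ is strong.
   Context: The scalar field is $\mathbb{R}$ or $\mathbb{C}$. A quasi-norm satisfies the axioms of a norm except that the triangle inequality is replaced by $\Vert f+g\Vert\le\kappa(\Vert f\Vert+\Vert g\Vert)$ for some constant $\kappa\ge1$; a quasi-Banach space is a vector space complete for the topology of a quasi-norm. A basis of $\mathbb{X}$ is a sequence $\mathcal{B}=(\mathbf{x}_n)_{n=1}^\infty$ whose closed linear span is $\mathbb{X}$ and for which there is a (unique) sequence $(\mathbf{x}_n^* )_{n=1}^\infty$ in $\mathbb{X}^*$ with $\mathbf{x}_n^*(\mathbf{x}_k)=\delta_{k,n}$. It is $M$-bounded if $\sup_n\Vert\mathbf{x}_n\Vert\,\Vert\mathbf{x}_n^*\Vert<\infty$ and semi-normalized if $0<\inf_n\Vert\mathbf{x}_n\Vert\le\sup_n\Vert\mathbf{x}_n\Vert<\infty$. For finite $A\subseteq\mathbb{N}$, $S_A(f)=\sum_{n\in A}\mathbf{x}_n^*(f)\mathbf{x}_n$. A set $A\subseteq\mathbb{N}$ is a greedy set of $f\in\mathbb{X}$ if $|\mathbf{x}_k^*(f)|\le|\mathbf{x}_n^*(f)|$ for all $n\in A$ and $k\in\mathbb{N}\setminus A$. A quasi-greedy basis is an $M$-bounded semi-normalized basis for which there is $C<\infty$ with $\Vert S_A(f)\Vert\le C\Vert f\Vert$ for all $f\in\mathbb{X}$ and all finite greedy sets $A$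 of $f$. A basis is strong if for every (infinite) subset $A$ of $\mathbb{N}$, the closed linear span of $\{\mathbf{x}_n: n\in A\}$ equals $\{f\in\mathbb{X}:\mathbf{x}_n^*(f)=0\text{ for all }n\in\mathbb{N}\setminus A\}$. *)

(* Defs.v *)
From HB Require Import structures.
From mathcomp Require Import all_boot all_order all_algebra finmap.
From mathcomp Require Import all_classical all_reals.
From mathcomp Require Import ereal topology normedtype.
From mathcomp Require Import complex.

Set Implicit Arguments.
Unset Strict Implicit.
Unset Printing Implicit Defensive.

Import Order.TTheory GRing.Theory Num.Theory.
Import numFieldNormedType.Exports.

Local Open Scope classical_set_scope.
Local Open Scope ring_scope.

Variant scalar_kind := RealScalars | ComplexScalars.

Definition scalars (R : realType) (k : scalar_kind) : numFieldType :=
  match k with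
  | RealScalars => R
  | ComplexScalars => R[i]
  end.

(* The norm of the library on R[i] takes its values in R[i]; [modulus] is the
   absolute value with values in R. *)
Definition modulus (R : realType) (k : scalar_kind) : scalars R k -> R :=
  match k return scalars R k -> R with
  | RealScalars => fun a : R => `|a|
  | ComplexScalars => fun a : R[i] => ComplexField.Normc.normc a
  end.

(* [qnorm_entourage] states that the topology and the uniformity of X are those
   of the quasi-norm. The balls of a quasi-norm do not satisfy the additive
   triangle inequality of [pseudoMetricType] (and need not be open), hence the
   formulation in terms of entourages. *)
HB.mixin Record Uniform_isQuasiNormed (R : realType) (k : scalar_kind) X
    & Uniform X & GRing.Lmodule (scalars R k) X := {
  qnorm : X -> R ;
  qnorm_ge0 : forall f, 0 <= qnorm f ;
  qnorm0_eq0 : forall f, qnorm f = 0 -> f = 0 ;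
  qnormZ : forall (a : scalars R k) f, qnorm (a *: f) = modulus a * qnorm f ;
  qnormD : exists2 kappa : R, 1 <= kappa &
    forall f g, qnorm (f + g) <= kappa * (qnorm f + qnorm g) ;
  qnorm_entourage :
    entourage = entourage_ (fun f (e : R) => [set g : X | qnorm (f - g) < e])
}.

#[short(type="quasiNormedModType")]
HB.structure Definition QuasiNormedModule (R : realType) (k : scalar_kind) :=
  {X of Uniform X & GRing.Lmodule (scalars R k) X & Uniform_isQuasiNormed R k X}.

(* Same axiom as [Uniform_isComplete], without its requirement of a
   distinguished point. *)
HB.mixin Record Uniform_isCauchyComplete X & Uniform X := {
  cauchy_converges : forall F : set_system X,
    ProperFilter F -> cauchy F -> exists f : X, F --> f
}.

#[short(type="quasiBanachType")]
HB.structure Definition QuasiBanach (R : realType) (k : scalar_kind) :=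
  {X of QuasiNormedModule R k X & Uniform_isCauchyComplete X}.

Section Bases.
Context {R : realType} {k : scalar_kind} {X : quasiBanachType R k}.
Local Notation K := (scalars R k).

Implicit Types (x : nat -> X) (xs : nat -> {scalar X}) (A : set nat) (f : X).

Definition dual_norm (phi : {scalar X}) : \bar R :=
  ereal_sup [set (modulus (phi f))%:E | f in [set f : X | qnorm f <= 1]].

Definition linear_span x A : set X :=
  [set f | exists (B : {fset nat}) (c : nat -> K),
    [set` B] `<=` A /\ f = \sum_(n <- B) c n *: x n].

Definition closed_span x A : set X := closure (linear_span x A).

(* The coordinate functionals xs are determined by x; they are carried along
   rather than chosen. Sequences are indexed from 0. *)
Record is_basis x xs : Prop := {
  basis_total : closed_span x [set: nat] = [set: X] ;
  basis_dual_continuous : forall n, continuous (xs n : X -> K) ;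
  basis_biorthogonal : forall n m, xs n (x m) = (m == n)%:R
}.

Definition M_bounded x xs : Prop :=
  (ereal_sup (range (fun n => (qnorm (x n))%:E * dual_norm (xs n))) < +oo)%E.

Definition semi_normalized x : Prop :=
  (0 < ereal_inf (range (fun n => (qnorm (x n))%:E)) /\
   ereal_sup (range (fun n => (qnorm (x n))%:E)) < +oo)%E.

Definition coord_proj x xs (A : {fset nat}) f : X :=
  \sum_(n <- A) xs n f *: x n.

Definition greedy_set xs f A : Prop :=
  forall n m, A n -> ~ A m -> modulus (xs m f) <= modulus (xs n f).

Record quasi_greedy x xs : Prop := {
  quasi_greedy_basis : is_basis x xs ;
  quasi_greedy_M_bounded : M_bounded x xs ;
  quasi_greedy_semi_normalized : semi_normalized x ;
  quasi_greedy_bound : exists C : R, forall f (A : {fset nat}),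
    greedy_set xs f [set` A] -> qnorm (coord_proj x xs A f) <= C * qnorm f
}.

Definition strong_basis x xs : Prop :=
  forall A, infinite_set A ->
    closed_span x A = [set f | forall n, ~ A n -> xs n f = 0].

End Bases.

(* Main.v *)
Require Import Defs.
From mathcomp Require Import all_boot all_order all_algebra finmap.
From mathcomp Require Import all_classical all_reals.
From mathcomp Require Import ereal topology normedtype.
From mathcomp Require Import complex.
From mathcomp Require Import ring.

(** If [h = f - g] with [g] a finite combination over [B] and all coefficients
    of [h] on [B] are nonzero, then [A = {n : |x_n^*(h)| >= t}], with [t] the
    least modulus of the coefficients of [h] on [B], is a finite greedy set of
    [h] containing [B]; hence [f - S_A f = h - S_A h] is at most a constant
    times [h]. The coefficients are made nonzero by an arbitrarily small
    perturbation of [g]. So every [f] is a limit of projections [S_A f], which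
    involve only the [x_n] in the support of [f]. *)

Set Implicit Arguments.
Unset Strict Implicit.
Unset Printing Implicit Defensive.

Import Order.TTheory GRing.Theory Num.Theory.
Import numFieldNormedType.Exports.

Local Open Scope classical_set_scope.
Local Open Scope ring_scope.

(** * The real-valued absolute value on both scalar fields *)

Section Modulus.
Context {R : realType} {k : scalar_kind}.
Implicit Types a b : scalars R k.

Definition real_scalar : R -> scalars R k :=
  match k return R -> scalars R k with
  | RealScalars => fun r => r
  | ComplexScalars => fun r => r%:C%C
  end.

Lemma modulus_ge0 a : 0 <= modulus a.
Proof.
by case: k a => [a|[u v]] /=; rewrite ?normr_ge0 ?sqrtr_ge0.
Qed.

Lemma modulus_eq0 a : modulus a = 0 -> a = 0.
Proof.
case: k a => [a /= /normr0_eq0 //|a]; exact: ComplexField.Normc.eq0_normc.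
Qed.

Lemma modulus_gt0 a : a != 0 -> 0 < modulus a.
Proof.
by move=> a0; rewrite lt0r modulus_ge0 andbT; apply: contra_neq a0 => /modulus_eq0.
Qed.

Lemma modulus0 : modulus (0 : scalars R k) = 0.
Proof. by case: k => /=; rewrite ?normr0 ?expr0n /= ?addr0 ?sqrtr0. Qed.

Lemma modulusM a b : modulus (a * b) = modulus a * modulus b.
Proof.
by case: k a b => [a b /=|a b]; [rewrite normrM|exact: ComplexField.Normc.normcM].
Qed.

Lemma modulus_real r : modulus (real_scalar r) = `|r|.
Proof.
by rewrite /real_scalar; case: k => //=; rewrite expr0n /= addr0 sqrtr_sqr.
Qed.

End Modulus.

(** [t] is the minimum of 1 and the values of [u] on [s]; the 1 covers the empty [s]. *)
Lemma finite_lower_bound (R : realType) (T : eqType) (s : seq T) (u : T -> R) :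
  {in s, forall n, 0 < u n} -> exists2 t, 0 < t & {in s, forall n, t <= u n}.
Proof.
elim: s => [_|n s IHs us]; first by exists 1.
have [m ms|t t0 ts] := IHs; first by apply: us; rewrite inE ms orbT.
exists (Num.min (u n) t); first by rewrite lt_min t0 us ?mem_head.
by move=> m; rewrite inE => /predU1P[->|/ts tm]; rewrite ge_min ?lexx ?tm ?orbT.
Qed.

(** * Closures and functionals in terms of the quasi-norm *)

Section QuasiNorm.
Context {R : realType} {k : scalar_kind} {X : quasiBanachType R k}.
Local Notation K := (scalars R k).
Implicit Types (f : X) (S : set X).

Lemma qnormN f : qnorm (- f) = qnorm f.
Proof.
rewrite -[in LHS](scale1r f) -scaleNr qnormZ.
suff -> : modulus (-1 : K) = 1 by rewrite mul1r.
by case: (k) => /=; rewrite ?normrN1 // oppr0 expr0n /= addr0 sqrtr_sqr normrN1.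
Qed.

(** The balls of a quasi-norm may fail to be open, but by [qnorm_entourage] they form a base of
    neighbourhoods of [f], which is enough to test closure. *)
Lemma closure_qnormP S f :
  closure S f <-> forall e, 0 < e -> exists2 g, S g & qnorm (f - g) < e.
Proof.
split=> [Sf e e0|Sf V].
  have : nbhs f [set g | qnorm (f - g) < e].
    apply/nbhsP; exists [set xy | qnorm (xy.1 - xy.2) < e].
      by rewrite qnorm_entourage; exists e.
    by move=> g; rewrite /xsection /= inE.
  by case/Sf => g [Sg fg]; exists g.
move=> /nbhsP[E]; rewrite qnorm_entourage => -[e /= e0 eE] EV.
have [g Sg fg] := Sf e e0; exists g; split=> //.
by apply: EV; rewrite /xsection /= inE; apply: eE.
Qed.

Lemma le_dual_norm (phi : {scalar X}) (D : R) f :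
  (dual_norm phi <= D%:E)%E -> modulus (phi f) <= D * qnorm f.
Proof.
move=> phiD; have [f0|f0] := eqVneq (qnorm f) 0.
  by rewrite f0 (qnorm0_eq0 _ f0) linear0 modulus0 mulr0.
have qf : 0 < qnorm f by rewrite lt0r f0 qnorm_ge0.
have mr : modulus (real_scalar (qnorm f)^-1 : K) = (qnorm f)^-1.
  by rewrite modulus_real gtr0_norm ?invr_gt0.
(* Rescaled to quasi-norm 1, [f] enters the supremum defining [dual_norm]. *)
have : ((modulus (phi (real_scalar (qnorm f)^-1 *: f)))%:E <= D%:E)%E.
  apply: le_trans phiD; apply: ereal_sup_ubound.
  by exists (real_scalar (qnorm f)^-1 *: f) => //=; rewrite qnormZ mr mulVf.
by rewrite lee_fin linearZ modulusM mr mulrC ler_pdivrMr.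
Qed.

End QuasiNorm.

(** * Coordinates, approximation and greedy projections *)

Section QuasiGreedy.
Context {R : realType} {k : scalar_kind} {X : quasiBanachType R k}.
Local Notation K := (scalars R k).
Context {x : nat -> X} {xs : nat -> {scalar X}}.
Implicit Types (f g h : X) (A B : {fset nat}).

(** Dividing the bound [M] on the products by a lower bound [c] of the [qnorm (x n)] bounds all the
    dual norms by [M / c]. *)
Lemma M_bounded_dual_le : M_bounded x xs -> semi_normalized x ->
  exists2 D, 0 < D & forall n f, modulus (xs n f) <= D * qnorm f.
Proof.
move=> Mb [x_gt0 _].
have [c c0 cx] : exists2 c : R, 0 < c & forall n, c <= qnorm (x n).
  have inf_le n : (ereal_inf (range (fun n => (qnorm (x n))%:E)) <=
                   (qnorm (x n))%:E)%E by apply: ereal_inf_lbound; exists n.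
  case: (ereal_inf _) x_gt0 inf_le => [c|_ /(_ 0)|] //; rewrite lte_fin => c0 cx.
  by exists c => // n; rewrite -lee_fin.
have [M M0 xM] : exists2 M : R, 0 < M &
    forall n, ((qnorm (x n))%:E * dual_norm (xs n) <= M%:E)%E.
  have le_sup n : ((qnorm (x n))%:E * dual_norm (xs n) <=
      ereal_sup (range (fun n => (qnorm (x n))%:E * dual_norm (xs n))))%E.
    by apply: ereal_sup_ubound; exists n.
  move: Mb le_sup; rewrite /M_bounded; case: (ereal_sup _) => [M _ xM|//|_ xM].
    exists (Num.max 1 M); first by rewrite lt_max ltr01.
    by move=> n; apply: le_trans (xM n) _; rewrite lee_fin le_max lexx orbT.
  by exists 1 => // n; apply: le_trans (xM n) (leNye _).
exists (M / c) => [|n f]; first by rewrite divr_gt0.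
apply: le_dual_norm.
have xn0 : 0 < qnorm (x n) := lt_le_trans c0 (cx n).
(* An infinite dual norm would make the product with [qnorm (x n) > 0] infinite, against [xM]. *)
move: (xM n); case: (dual_norm _) => [d|/=|_]; last by rewrite leNye.
  rewrite -EFinM !lee_fin => xd; have [d0|d0] := ltP d 0.
    by rewrite (le_trans (ltW d0)) // ltW // divr_gt0.
  by rewrite ler_pdivlMr // mulrC (le_trans _ xd) // ler_wpM2r.
by rewrite gt0_muley ?lte_fin.
Qed.

Lemma coord_projB A f g :
  coord_proj x xs A (f - g) = coord_proj x xs A f - coord_proj x xs A g.
Proof.
by rewrite /coord_proj -sumrB; apply: eq_bigr => n _; rewrite linearB scalerBl.
Qed.

Context (basis_x : is_basis x xs).

Lemma coord_sum B (c : nat -> K) m :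
  xs m (\sum_(n <- B) c n *: x n) = if m \in B then c m else 0.
Proof.
rewrite linear_sum /= (eq_bigr (fun n => c n * (n == m)%:R)); last first.
  by move=> n _; rewrite linearZ /= (basis_biorthogonal basis_x).
case: ifPn => mB.
  rewrite (big_fsetD1 m) //= eqxx mulr1 big1_seq ?addr0 // => n /=.
  by rewrite in_fsetD1 => /andP[/negbTE -> _]; rewrite mulr0.
rewrite big1_seq // => n /= nB; case: eqP => [nm|]; last by rewrite mulr0.
by rewrite -nm nB in mB.
Qed.

Lemma coord_proj_sum A B (c : nat -> K) : {subset B <= A} ->
  coord_proj x xs A (\sum_(n <- B) c n *: x n) = \sum_(n <- B) c n *: x n.
Proof.
move=> BA; rewrite /coord_proj.
rewrite (eq_bigr (fun n => if n \in B then c n *: x n else 0)); last first.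
  by move=> n _; rewrite coord_sum; case: ifP; rewrite ?scale0r.
rewrite -big_mkcond -big_filter; apply: perm_big; apply: uniq_perm => //.
  by rewrite filter_uniq.
by move=> n; rewrite mem_filter; case: (boolP (n \in B)) => //= /BA ->.
Qed.

Lemma total_approx f e : 0 < e -> exists B (c : nat -> K),
  qnorm (f - \sum_(n <- B) c n *: x n) < e.
Proof.
move=> e0; have : closed_span x [set: nat] f by rewrite (basis_total basis_x).
move/closure_qnormP => /(_ e e0) [_ [B [c [_ ->]]] fe].
by exists B, c.
Qed.

Lemma total_approx_neq0 f e : 0 < e -> exists B (c : nat -> K),
  let h := f - \sum_(n <- B) c n *: x n in
  qnorm h < e /\ {in B, forall n, xs n h != 0}.
Proof.
move=> e0; have [kappa kappa1 qD] := @qnormD R k X.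
have kappa0 : 0 < kappa by apply: lt_le_trans kappa1.
have e'0 : 0 < e / (2 * kappa) by rewrite divr_gt0 ?mulr_gt0.
have [B [c fe]] := total_approx f e'0.
set h := f - _ in fe.
(* [z] marks the vanishing coefficients of [h]: adding [a *: v] turns those over [B] into [a] and
   leaves the others alone. *)
pose z n : K := (xs n h == 0)%:R; pose v := \sum_(n <- B) z n *: x n.
(* This makes [eta * qnorm v < e / (2 * kappa)], so that the quasi-triangle inequality gives a total
   below [e]; the 1 keeps the denominator positive when [v = 0]. *)
pose eta := e / (2 * kappa) / (1 + qnorm v).
have v0 : 0 < 1 + qnorm v by rewrite ltr_wpDr ?qnorm_ge0.
have eta0 : 0 < eta by rewrite divr_gt0.
pose a : K := real_scalar eta.
have modulus_a : modulus a = eta by rewrite modulus_real gtr0_norm.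
have a0 : a != 0.
  by apply/eqP => a0; move: eta0; rewrite -modulus_a a0 modulus0 ltxx.
exists B, (fun n => c n - a * z n) => /=.
have -> : f - \sum_(n <- B) (c n - a * z n) *: x n = h + a *: v.
  rewrite /h /v scaler_sumr -addrA; congr (_ + _).
  rewrite -sumrN -sumrN -big_split /=; apply: eq_bigr => n _.
  by rewrite scalerBl opprB addrC scalerA.
split.
  apply: le_lt_trans (qD _ _) _; rewrite qnormZ modulus_a -ltr_pdivlMl //.
  have av : eta * qnorm v < e / (2 * kappa).
    by rewrite /eta -mulrA gtr_pMr // ltr_pdivrMl // mulr1 ltrDr.
  apply: lt_le_trans (ltrD fe av) _.
  by rewrite le_eqVlt; apply/orP; left; apply/eqP; field; rewrite gt_eqF.
move=> n nB; rewrite linearD linearZ /= coord_sum nB /z.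
by have [->|hn] := eqVneq (xs n h) 0; rewrite ?add0r ?mulr1 // mulr0 addr0.
Qed.

Section BoundedDual.
Context {D : R} (D0 : 0 < D)
  (xsD : forall n f, modulus (xs n f) <= D * qnorm f).

(** Take a combination over [B] within [t / D] of [h]: off [B] its coordinates vanish, so those of
    [h] are below [t] there. *)
Lemma large_coord_finite h t : 0 < t ->
  exists A, forall n, (n \in A) = (t <= modulus (xs n h)).
Proof.
move=> t0; have tD0 : 0 < t / D by rewrite divr_gt0.
have [B [c he]] := total_approx h tD0.
exists [fset n in B | t <= modulus (xs n h)]%fset => n.
rewrite !inE /=; case: (boolP (n \in B)) => //= nB.
apply/esym/negbTE; rewrite -ltNge.
have := xsD n (h - \sum_(n <- B) c n *: x n).
rewrite linearB /= coord_sum (negbTE nB) subr0 => /le_lt_trans; apply.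
by rewrite -ltr_pdivlMl // mulrC.
Qed.

Lemma closed_span_coord0 (A : set nat) f n :
  closed_span x A f -> ~ A n -> xs n f = 0.
Proof.
move=> /closure_qnormP Af An; apply/eqP/contraT => /modulus_gt0 fn0.
(* An element of the span of [A] this close to [f] has zero [n]-th coordinate, which contradicts
   [xsD]. *)
have fnD0 : 0 < modulus (xs n f) / D by rewrite divr_gt0.
have [_ [B [c [BA ->]]] fg] := Af _ fnD0.
have := xsD n (f - \sum_(n <- B) c n *: x n).
have /negbTE nB : n \notin B by apply/negP => nB; apply: An; apply: BA.
rewrite linearB /= coord_sum nB subr0 leNgt.
by rewrite -ltr_pdivlMl // mulrC fg.
Qed.

Lemma coord_proj_approx C f e :
  (forall f A, greedy_set xs f [set` A] ->
    qnorm (coord_proj x xs A f) <= C * qnorm f) ->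
  0 < e -> exists A, qnorm (f - coord_proj x xs A f) < e.
Proof.
move=> qg e0; have [kappa kappa1 qD] := @qnormD R k X.
have kappa0 : 0 < kappa by apply: lt_le_trans kappa1.
have C0 : 0 < 1 + `|C| by rewrite ltr_wpDr.
(* The factor [kappa * (1 + |C|)] bounds [h - S_A h] in terms of [h]; the absolute value is there
   because [C] has no prescribed sign. *)
have e'0 : 0 < e / (kappa * (1 + `|C|)) by rewrite divr_gt0 ?mulr_gt0.
have [B [c []]] := total_approx_neq0 f e'0; set g := \sum_(n <- B) _.
set h := f - g => he hB.
have [t t0 tB] : exists2 t, 0 < t & {in B, forall n, t <= modulus (xs n h)}.
  by apply: finite_lower_bound => n /hB /modulus_gt0.
have [A At] := large_coord_finite h t0; exists A.
have greedyA : greedy_set xs h [set` A].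
  move=> n m /=; rewrite !At => tn /negP; rewrite -ltNge => /ltW mt.
  exact: le_trans tn.
(* Since [B] lies in [A], the projection fixes [g], which cancels. *)
have -> : f - coord_proj x xs A f = h - coord_proj x xs A h.
  rewrite /h coord_projB [coord_proj _ _ _ g]coord_proj_sum -/g.
    by rewrite opprB addrA subrK.
  by move=> n /tB; rewrite At.
apply: le_lt_trans (qD _ _) _; rewrite qnormN.
apply: (@le_lt_trans _ _ (kappa * (1 + `|C|) * qnorm h)).
  rewrite -mulrA ler_wpM2l ?(ltW kappa0) // mulrDl mul1r lerD2l.
  by rewrite (le_trans (qg _ _ greedyA)) // ler_wpM2r ?qnorm_ge0 ?ler_norm.
by rewrite -ltr_pdivlMl ?mulr_gt0 // mulrC.
Qed.

End BoundedDual.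

End QuasiGreedy.

Theorem corollary3p2 (R : realType) (k : scalar_kind) (X : quasiBanachType R k)
    (x : nat -> X) (xs : nat -> {scalar X}) :
  quasi_greedy x xs -> strong_basis x xs.
Proof.
move=> [basis_x Mb sn [C qg]] A _.
have [D D0 xsD] := M_bounded_dual_le Mb sn.
apply/seteqP; split=> f /= Af.
  by move=> n; apply: (closed_span_coord0 basis_x D0 xsD).
apply/closure_qnormP => e e0.
have [B fB] := coord_proj_approx basis_x D0 xsD f qg e0.
exists (coord_proj x xs B f) => //.
(* The terms of the projection with index outside [A] vanish by hypothesis on [f], which leaves a
   combination over the part of [B] in [A]. *)
exists [fset n in B | n \in A]%fset, (fun n => xs n f); split.
  by move=> n /=; rewrite !inE /= => /andP[_]; rewrite inE.
rewrite /coord_proj big_fset /= [RHS]big_mkcond; apply: eq_bigr => n _.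
by case: ifPn => // /negP; rewrite inE => /Af ->; rewrite scale0r.
Qed.
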